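(* Let $q\ge2$ and let $T$ be a $q$-regular tree. The Neretin group $N_q$ admits a unique group topology such that the natural embedding $\operatorname{Aut}(T)\to N_q$ is continuous and open. With this topology, $N_q$ is a totally disconnected locally compact group.
   Context: A tree is $q$-regular if every vertex has degree $q+1$; in a rooted $q$-regular tree, instead, the root has degree $q$ and all other vertices have degree $q+1$. The boundary $\partial T$ is the set of ends of $T$, i.e. classes of rays (infinite sequences of distinct, consecutively adjacent vertices) modulo agreeing after removal of finite initial segments, with its usual compact topology (induced by the metric $d_o(\xi,\eta)=e^{-(\xi,\eta)_o}$, where $o$ is a base vertex and $(\xi,\eta)_o$ is the length of the common initial segment of the rays from $o$ representing $\xi,\eta$). A finite $q$-regular subtree $F\subseteq T$ is a finite subtree each of whose vertices has degree (in $F$) either $1$ (a leaf) or $q+1$ (an internal vertex). For such a nonempty $F$, $T\setminus F$ denotes the forest of rooted $q$-regular trees obtained from $T$ by removing all edges and all internal vertices of $F$, with the leaves of $F$ as roots. Its boundary (the disjoint union of the boundaries of its component trees) is identified with $\partial T$. An isomorphism of (rooted) forests $\phi\colon T\setminus F_1\to T\setminus F_2$, with $F_1,F_2$ finite $q$-regular subtrees, induces a homeomorphism $\phi_*$ of $\partial T$, called a spheromorphism. The Neretin group $N_q$ is the group of all spheromorphisms of $\partial T$ under composition. The natural embedding $\operatorname{Aut}(T)\to N_q$ sends an automorphism to the homeomorphism of $\partial T$ it induces (which is a spheromorphism). $\operatorname{Aut}(T)$ carries the compact-open topology coming from its action on the (discrete) vertex set of $T$, i.e. the topology of pointwise convergence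 on vertices. *)

(* Defs.v *)
From HB Require Import structures.
From mathcomp Require Import all_boot finmap.
From mathcomp Require Import all_classical topology function_spaces.
From mathcomp Require Import separation_axioms.

Set Implicit Arguments.
Unset Strict Implicit.
Unset Printing Implicit Defensive.

Local Open Scope classical_set_scope.
Local Open Scope card_scope.
Local Open Scope quotient_scope.

Section Walks.
Variables (V : eqType) (e : rel V).

Definition walk_in (A : set V) (x y : V) :=
  exists p : seq V, [/\ path e x p, last x p = y & [set` p] `<=` A].

Definition walk_connected (A : set V) :=
  forall x y, A x -> A y -> walk_in A x y.

End Walks.

Record regular_tree (q : nat) := RegularTree {
  vertex :> choiceType;
  adj : rel vertex;
  adj_sym : symmetric adj;
  adj_irr : irreflexive adj;
  vertex_inhabited : inhabited vertex;
  tree_connected : walk_connected adj [set: vertex];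
  (* the cycles of length 2 are the edges traversed back and forth *)
  tree_acyclic : forall c : seq vertex, ucycle adj c -> size c <= 2;
  tree_degree : forall x, [set y | adj x y] #= `I_q.+1
}.

Section Forests.
Variables (q : nat) (T : regular_tree q).
Implicit Types (F G : set T) (x y : T).

(* The degree of [x] in the subgraph of [T] induced by [F] is [n]; a subtree is
   always the subgraph induced by its set of vertices. *)
Definition degree_in F x (n : nat) := [set y | F y /\ adj x y] #= `I_n.

Definition leaf F x := F x /\ degree_in F x 1.
Definition internal F x := F x /\ degree_in F x q.+1.

Definition regular_subtree F :=
  [/\ finite_set F, F !=set0, walk_connected (@adj q T) F
    & forall x, F x -> leaf F x \/ internal F x].

(* The forest T \ F, whose roots are the leaves of [F]. *)
Definition forest_vertex F x := ~ internal F x.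
Definition forest_adj F x y :=
  [/\ forest_vertex F x, forest_vertex F y, adj x y & ~ (F x /\ F y)].

(* Only the values of [phi] on the vertices of T \ F1 matter. *)
Definition forest_iso F1 F2 (phi : T -> T) :=
  [/\ set_bij (forest_vertex F1) (forest_vertex F2) phi,
      (forall x y, forest_vertex F1 x -> forest_vertex F1 y ->
        (forest_adj F1 x y <-> forest_adj F2 (phi x) (phi y)))
    & forall x, forest_vertex F1 x -> (leaf F1 x <-> leaf F2 (phi x))].

End Forests.

Section Boundary.
Variables (q : nat) (T : regular_tree q).

Definition is_ray (r : nat -> T) :=
  injective r /\ forall n, adj (r n) (r n.+1).

Definition ray := set_type [set r | is_ray r].

HB.instance Definition _ := Choice.on ray.

Definition ray_equiv (r s : ray) :=
  `[< exists m n, forall k, val r (m + k) = val s (n + k) >].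

Lemma ray_equiv_refl : reflexive ray_equiv.
Proof. by move=> r; apply/asboolP; exists 0, 0. Qed.

Lemma ray_equiv_sym : symmetric ray_equiv.
Proof.
by move=> r s; apply/asboolP/asboolP => -[m [n rs]]; exists n, m => k;
  rewrite rs.
Qed.

Lemma ray_equiv_trans : transitive ray_equiv.
Proof.
move=> s r t /asboolP[m [n rs]] /asboolP[m' [n' st]]; apply/asboolP.
exists (m + m'), (n' + n) => k.
by rewrite -addnA rs addnCA st addnA.
Qed.

Canonical ray_equivRel :=
  EquivRel ray_equiv ray_equiv_refl ray_equiv_sym ray_equiv_trans.

Definition boundary := {eq_quot ray_equivRel}.

HB.instance Definition _ := Choice.on boundary.
HB.instance Definition _ := EqQuotient.on boundary.

Definition end_of (r : ray) : boundary := \pi r.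

Lemma end_ofP (r s : ray) : end_of r = end_of s <->
  exists m n, forall k, val r (m + k) = val s (n + k).
Proof.
rewrite /end_of; split => [/eqmodP/asboolP//|rs].
by apply/eqmodP/asboolP.
Qed.

Lemma end_ofK (e : boundary) : end_of (repr e) = e.
Proof. exact: reprK. Qed.

(* Every end is represented by a ray of T \ F, so [f] is determined by [phi];
   it is automatically a homeomorphism for the usual topology of the boundary,
   which is therefore not needed to single out the spheromorphisms. *)
Definition induces (F : set T) (phi : T -> T) (f : boundary -> boundary) :=
  forall r : ray, (forall n, forest_adj F (val r n) (val r n.+1)) ->
    exists2 s : ray, val s = phi \o val r & f (end_of r) = end_of s.

Definition spheromorphism (f : boundary -> boundary) :=
  exists F1 F2 phi, [/\ regular_subtree F1, regular_subtree F2,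
    forest_iso F1 F2 phi & induces F1 phi f].

Definition neretin := set_type [set f | spheromorphism f].

HB.instance Definition _ := Choice.on neretin.

End Boundary.

Section SubtreeTheory.
Variables (q : nat) (T : regular_tree q).
Implicit Types (F G : set T) (x y : T).

Let adjC x y : adj x y -> adj y x.
Proof. by rewrite adj_sym. Qed.

Lemma card1P (X : Type) (A : set X) : A #= `I_1 <-> exists u, A = [set u].
Proof.
split=> [/card_set_bijP[f [fA finj fs]]|[u ->]]; last exact: card_set1.
have [u Au fu] := fs 0 isT; exists u; apply/seteqP; split=> [v Av|_ -> //].
apply: finj; rewrite ?inE// fu.
by have := fA _ Av; rewrite /= ltnS leqn0 => /eqP.
Qed.

Lemma card_full (X : choiceType) (A B : set X) n :
  A `<=` B -> B #= `I_n -> A #= `I_n -> B `<=` A.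
Proof.
move=> AB Bn An.
have fB : finite_set B by apply/finite_setP; exists n.
have fA : finite_set A by apply/finite_setP; exists n.
have /(fcard_eq fA fB) cAB : A #= B.
  by apply: card_eq_trans An _; rewrite card_eq_sym.
have sAB : (fset_set A `<=` fset_set B)%fset.
  by apply/fsubsetP => z; rewrite !in_fset_set// !inE => /AB.
have := fsubset_cardP cAB => /(_ _).
move=> eqAB z Bz.
have : z \in fset_set B by rewrite in_fset_set// inE.
by rewrite -(fsubset_cardP cAB sAB) in_fset_set// inE.
Qed.

Lemma degree_full F x : degree_in F x q.+1 <-> (forall y, adj x y -> F y).
Proof.
split=> [dx y xy|xF].
  by have [] := card_full (fun y => @proj2 (F y) (adj x y)) (tree_degree x) dx xy.
rewrite /degree_in (_ : [set _ | _] = [set y | adj x y]); first exact: tree_degree.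
by apply/seteqP; split=> y /= => [[]|xy] //; split=> //; apply: xF.
Qed.

Lemma degree_one F x : degree_in F x 1 <->
  exists u, [/\ F u, adj x u & forall y, F y -> adj x y -> y = u].
Proof.
rewrite /degree_in card1P; split=> -[u].
  move=> Fu; exists u; have [] : [set y | F y /\ adj x y] u by rewrite Fu.
  split=> // y Fy xy; by have : [set y | F y /\ adj x y] y by []; rewrite Fu.
move=> [Fu xu uu]; exists u; apply/seteqP; split=> y /=; first by case; exact: uu.
by move=> ->.
Qed.

Lemma walk_refl F x : walk_in (@adj q T) F x x.
Proof. by exists [::]; split. Qed.

Lemma walk_step F x y z :
  adj x y -> F y -> walk_in (@adj q T) F y z -> walk_in (@adj q T) F x z.
Proof.
move=> xy Fy [p [yp <- pF]]; exists (y :: p); split=> //=; first by rewrite xy.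
by move=> w /=; rewrite inE => /orP[/eqP->//|/pF].
Qed.

Lemma walk_trans F x y z : walk_in (@adj q T) F x y ->
  walk_in (@adj q T) F y z -> walk_in (@adj q T) F x z.
Proof.
move=> [p [xp <- pF]] [p' [yp' <- pF']]; exists (p ++ p'); split.
- by rewrite cat_path xp.
- by rewrite last_cat.
- by move=> w /=; rewrite mem_cat => /orP[/pF|/pF'].
Qed.

Lemma walk_sym F x y : F x -> walk_in (@adj q T) F x y ->
  walk_in (@adj q T) F y x.
Proof.
move=> + [p [+ <- +]]; elim: p x => [|z p IH] x Fx /=.
  by move=> *; exact: walk_refl.
move=> /andP[xz zp] pF.
have Fz : F z by apply: pF; rewrite /= mem_head.
apply: walk_trans (IH _ Fz zp _) _.
  by move=> w wp; apply: pF; rewrite /= inE wp orbT.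
exact: walk_step (adjC xz) Fx (walk_refl _ _).
Qed.

Lemma walk_sub F G x y : F `<=` G -> walk_in (@adj q T) F x y ->
  walk_in (@adj q T) G x y.
Proof. by move=> FG [p [xp xy pF]]; exists p; split=> //; apply: subset_trans FG. Qed.

Lemma internal_full F x : internal F x <-> F x /\ forall y, adj x y -> F y.
Proof. by split=> -[Fx /degree_full]. Qed.

Lemma internal_sub F G x : F `<=` G -> internal F x -> internal G x.
Proof.
by move=> FG /internal_full[/FG Gx xF]; apply/internal_full; split=> // y /xF/FG.
Qed.

Lemma forest_vertex_sub F G x : F `<=` G -> forest_vertex G x -> forest_vertex F x.
Proof. by move=> FG Gx Fx; apply/Gx/(internal_sub FG). Qed.

Lemma forest_adj_sub F G x y : F `<=` G -> forest_adj G x y -> forest_adj F x y.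
Proof.
move=> FG [Gx Gy xy nG]; split=> //; [exact: forest_vertex_sub Gx|
  exact: forest_vertex_sub Gy|by move=> [/FG ? /FG ?]; apply: nG].
Qed.

Lemma forest_adjP F x y : forest_vertex F x -> adj x y -> ~ (F x /\ F y) ->
  forest_adj F x y.
Proof.
move=> Fx xy nF; split=> //.
by move=> /internal_full[Fy yF]; apply: nF; split=> //; apply/yF/adjC.
Qed.

Lemma forest_leaf F x : regular_subtree F -> forest_vertex F x -> F x -> leaf F x.
Proof. by move=> [_ _ _ dF] nx /dF[]. Qed.

Lemma forest_notin F x : ~ F x -> forest_vertex F x.
Proof. by move=> nF []. Qed.

Definition thicken F : set T := [set y | F y \/ exists2 x, F x & adj x y].

Lemma sub_thicken F : F `<=` thicken F.
Proof. by move=> x; left. Qed.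

Lemma uniq_nbr F x u v : walk_connected (@adj q T) F -> F u -> F v -> ~ F x ->
  adj u x -> adj v x -> u = v.
Proof.
move=> cF Fu Fv nFx ux vx; have [p [up uv pF]] := cF _ _ Fu Fv.
move: uv; case: (shortenP up) => p' up' unp' sp' p'v.
have := @tree_acyclic q T [:: x, u & p'].
rewrite /ucycle /= rcons_path up' p'v vx (adjC ux) /=.
have -> : x \notin u :: p'.
  apply/negP; rewrite inE => /orP[/eqP xu|/sp' xp]; apply: nFx; first by rewrite xu.
  exact: pF.
move: unp' => /= -> /= => /(_ isT).
by move: p'v; case: p' {up' sp'} => [|? ?].
Qed.

Lemma no_nbrs F x y u v : walk_connected (@adj q T) F -> F u -> F v ->
  ~ F x -> ~ F y -> adj u x -> adj v y -> adj x y -> False.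
Proof.
move=> cF Fu Fv nFx nFy ux vy xy; have [p [up uv pF]] := cF _ _ Fu Fv.
move: uv; case: (shortenP up) => p' up' unp' sp' p'v.
have := @tree_acyclic q T [:: y, x, u & p'].
rewrite /ucycle /= rcons_path up' p'v vy (adjC ux) (adjC xy) /=.
have nF z : ~ F z -> z \notin u :: p'.
  move=> nFz; apply/negP; rewrite inE => /orP[/eqP zu|/sp' zp]; apply: nFz.
    by rewrite zu.
  exact: pF.
rewrite in_cons (negbTE (nF _ nFy)) orbF (nF _ nFx).
move: unp' => /= -> /=; rewrite andbT.
suff -> : y != x by move=> /(_ isT).
by apply/eqP => yx; move: xy; rewrite yx adj_irr.
Qed.

Lemma thicken_regular F : finite_set F -> F !=set0 ->
  walk_connected (@adj q T) F -> regular_subtree (thicken F).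
Proof.
move=> fF [o Fo] cF; split.
- rewrite (_ : thicken F = F `|` \bigcup_(x in F) [set y | adj x y]).
    rewrite finite_setU; split=> //; apply: bigcup_finite => // x _.
    by apply/finite_setP; exists q.+1; exact: tree_degree.
  apply/seteqP; split=> y [Fy|[x Fx xy]]; by [left|right; exists x].
- by exists o; left.
- have toF x : thicken F x -> walk_in (@adj q T) (thicken F) x o.
    case=> [Fx|[y Fy yx]]; first exact: walk_sub (@sub_thicken F) (cF _ _ Fx Fo).
    apply: walk_step (adjC yx) _ _; first by left.
    exact: walk_sub (@sub_thicken F) (cF _ _ Fy Fo).
  move=> x y tx ty; apply: walk_trans (toF _ tx) _.
  by apply: walk_sym (toF _ ty).
- move=> x tx; have [Fx|nFx] := pselect (F x).
    right; apply/internal_full; split=> // y xy; right; by exists x.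
  left; split=> //; apply/degree_one.
  case: tx => // -[u Fu ux]; exists u; split; [by left|exact: adjC|].
  move=> y [Fy|[v Fv vy]] xy.
    exact: uniq_nbr cF Fy Fu nFx (adjC xy) ux.
  have [Fy|nFy] := pselect (F y); first exact: uniq_nbr cF Fy Fu nFx (adjC xy) ux.
  by have := no_nbrs cF Fu Fv nFx nFy ux vy xy.
Qed.

Lemma star_regular x : regular_subtree (thicken [set x]).
Proof.
apply: thicken_regular => //; first by exists x.
by move=> _ _ -> ->; exact: walk_refl.
Qed.

Lemma iter_regular n F : regular_subtree F -> regular_subtree (iter n thicken F).
Proof.
move=> rF; elim: n => //= n [fF F0 cF _]; exact: thicken_regular.
Qed.

Lemma iter_sub n F : F `<=` iter n thicken F.
Proof. by elim: n => //= n IH; apply: subset_trans IH (@sub_thicken _). Qed.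

Lemma iter_leq m n F : m <= n -> iter m thicken F `<=` iter n thicken F.
Proof. by move=> /subnK <-; rewrite iterD; exact: iter_sub. Qed.

Lemma iter_cover F x : F !=set0 -> exists n, iter n thicken F x.
Proof.
move=> [o]; have [p [+ <- _]] := @tree_connected q T o x I I.
elim: p o F => [|y p IH] o F /=; first by exists 0.
move=> /andP[oy yp] Fo; have [|n nF] := IH _ (thicken F) yp.
  by right; exists o.
by exists n.+1; rewrite iterSr.
Qed.

Lemma common_regular F G : regular_subtree F -> regular_subtree G ->
  exists H, [/\ regular_subtree H, F `<=` H & G `<=` H].
Proof.
move=> rF [/finite_seqP[s ->] _ _ _].
have F0 : F !=set0 by case: rF.
suff [n sn] : exists n, [set` s] `<=` iter n thicken F.
  by exists (iter n thicken F); split=> //; [exact: iter_regular|exact: iter_sub].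
elim: s => [|x s [n IH]]; first by exists 0.
have [m xm] := iter_cover x F0; exists (maxn m n) => y /=.
rewrite inE => /orP[/eqP ->|/IH].
  exact: iter_leq (leq_maxl m n) _ xm.
exact: iter_leq (leq_maxr m n) _.
Qed.

Definition iso_pair F1 F2 (phi psi : T -> T) := [/\
   (forall x, forest_vertex F1 x -> forest_vertex F2 (phi x) /\ psi (phi x) = x),
   (forall x, forest_vertex F2 x -> forest_vertex F1 (psi x) /\ phi (psi x) = x),
   (forall x y, forest_vertex F1 x -> forest_vertex F1 y ->
        (forest_adj F1 x y <-> forest_adj F2 (phi x) (phi y)))
    & forall x, forest_vertex F1 x -> (leaf F1 x <-> leaf F2 (phi x))].

Lemma iso_pair_sym F1 F2 phi psi :
  iso_pair F1 F2 phi psi -> iso_pair F2 F1 psi phi.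
Proof.
move=> [p12 p21 pa pl]; split=> // [x y Fx Fy|x Fx].
  have [Fx' {1}<-] := p21 _ Fx; have [Fy' {1}<-] := p21 _ Fy.
  exact: iff_sym (pa _ _ Fx' Fy').
have [Fx' {1}<-] := p21 _ Fx; exact: iff_sym (pl _ Fx').
Qed.

Lemma forest_isoP F1 F2 phi :
  forest_iso F1 F2 phi <-> exists psi, iso_pair F1 F2 phi psi.
Proof.
split=> [[[p12 pinj psurj] pa pl]|[psi [p12 p21 pa pl]]]; last first.
  split=> //; split.
  - by move=> x /p12[].
  - move=> x y; rewrite !inE => /p12[_ {2}<-] /p12[_ {2}<-] -> //.
  - by move=> y /p21[Fy yE]; exists (psi y).
have /choice[psi psiP] : forall y, exists x, forest_vertex F2 y ->
    forest_vertex F1 x /\ phi x = y.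
  move=> y; have [Fy|nFy] := pselect (forest_vertex F2 y); last by exists y.
  by have [x Fx xy] := psurj _ Fy; exists x.
exists psi; split=> // x Fx; split; first exact: p12.
by have [Fy yE] := psiP _ (p12 _ Fx); apply: pinj => //; rewrite inE.
Qed.

Section Expand.
Variables (F1 F2 G2 : set T) (phi psi : T -> T).
Hypotheses (rF1 : regular_subtree F1) (rF2 : regular_subtree F2).
Hypotheses (rG2 : regular_subtree G2) (FG2 : F2 `<=` G2).
Hypothesis isoF : iso_pair F1 F2 phi psi.

Let G1 : set T := [set x | F1 x \/ forest_vertex F1 x /\ G2 (phi x)].

Let FG1 : F1 `<=` G1. Proof. by move=> x; left. Qed.

Let G1E x : forest_vertex F1 x -> G1 x <-> G2 (phi x).
Proof.
move=> Dx; split=> [[Fx|[]//]|Gx]; last by right.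
have [_ _ _ pl] := isoF.
by apply: FG2; have [] := (pl _ Dx).1 (forest_leaf rF1 Dx Fx).
Qed.

Let F1E x : forest_vertex F1 x -> F1 x <-> F2 (phi x).
Proof.
have [p12 _ _ pl] := isoF.
move=> Dx; split=> Fx; first by have [] := (pl _ Dx).1 (forest_leaf rF1 Dx Fx).
by have [] := (pl _ Dx).2 (forest_leaf rF2 (p12 _ Dx).1 Fx).
Qed.

Let G1internal x : forest_vertex F1 x -> internal G1 x <-> internal G2 (phi x).
Proof.
have [p12 p21 pa pl] := isoF.
move=> Dx; split=> /internal_full[Gx xG]; apply/internal_full.
  split=> [|y xy]; first exact/G1E.
  have [[? ?]|nF] := pselect (F2 (phi x) /\ F2 y); first exact: FG2.
  have fxy := forest_adjP (p12 _ Dx).1 xy nF.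
  have [_ Dy _ _] := fxy; have [Dy' yE] := p21 _ Dy.
  rewrite -yE; apply/(G1E Dy')/xG.
  by rewrite -yE in fxy; have [] := (pa _ _ Dx Dy').2 fxy.
split=> [|y xy]; first exact/G1E.
have [[? ?]|nF] := pselect (F1 x /\ F1 y); first exact: FG1.
have fxy := forest_adjP Dx xy nF; have [_ Dy _ _] := fxy.
by apply/(G1E Dy)/xG; have [] := (pa _ _ Dx Dy).1 fxy.
Qed.

Let G1leaf x : forest_vertex F1 x -> leaf G2 (phi x) -> leaf G1 x.
Proof.
have [p12 p21 pa pl] := isoF.
move=> Dx [Gx /degree_one[u' [Gu' xu' uu']]].
have Dpx := (p12 _ Dx).1.
split; first exact/G1E.
apply/degree_one; have [Fx|nFx] := pselect (F1 x).
  have [_ /degree_one[u [Fu xu uu]]] := forest_leaf rF1 Dx Fx.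
  exists u; split=> [||y Gy xy]; [exact: FG1|by []|].
  have [Fy|nFy] := pselect (F1 y); first exact: uu.
  have fxy : forest_adj F1 x y by apply: forest_adjP => // -[].
  have [_ Dy _ _] := fxy.
  have [_ _ pxy nF2] := (pa _ _ Dx Dy).1 fxy.
  have Fpx : F2 (phi x) by apply/F1E.
  have [_ /degree_one[v [Fv xv _]]] := forest_leaf rF2 Dpx Fpx.
  exfalso; apply: nF2; split=> //.
  by rewrite (uu' _ _ pxy) -?(uu' _ (FG2 Fv) xv)//; apply/G1E.
have nFpx : ~ F2 (phi x) by move=> /F1E-/(_ Dx).
have fxu' : forest_adj F2 (phi x) u' by apply: forest_adjP => // -[].
have [_ Du' _ _] := fxu'; have [Du uE] := p21 _ Du'.
exists (psi u'); split.
- by apply/(G1E Du); rewrite uE.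
- by rewrite -uE in fxu'; have [] := (pa _ _ Dx Du).2 fxu'.
- move=> y Gy xy; have fxy : forest_adj F1 x y by apply: forest_adjP => // -[].
  have [_ Dy _ _] := fxy; have [_ _ pxy _] := (pa _ _ Dx Dy).1 fxy.
  by rewrite -(p12 _ Dy).2 (uu' (phi y))//; apply/G1E.
Qed.

Let G1walk y : forest_vertex F2 y -> G2 y ->
  exists2 z, F1 z & walk_in (@adj q T) G1 (psi y) z.
Proof.
have [p12 p21 pa pl] := isoF.
have [_ [o Fo] _ _] := rF2; have [_ _ cG _] := rG2.
move=> Dy Gy; have [p [+ po +]] := cG _ _ Gy (FG2 Fo).
rewrite -{}po in Fo; elim: p y Fo Dy Gy => [|w p IH] y /= Fp Dy Gy.
  move=> _ _; exists (psi y); last exact: walk_refl.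
  by have [Dpy yE] := p21 _ Dy; apply/(F1E Dpy); rewrite yE.
move=> /andP[yw wp] pG; have [Dpy yE] := p21 _ Dy.
have [Fy|nFy] := pselect (F2 y).
  exists (psi y); last exact: walk_refl.
  by apply/(F1E Dpy); rewrite yE.
have fyw : forest_adj F2 y w by apply: forest_adjP => // -[].
have [_ Dw _ _] := fyw; have [Dpw wE] := p21 _ Dw.
have Gw : G2 w by apply: pG; rewrite /= mem_head.
have [|z Fz wz] := IH _ Fp Dw Gw wp.
  by move=> v vp; apply: pG; rewrite /= inE vp orbT.
exists z => //; apply: walk_step wz.
  by rewrite -{}yE -{}wE in fyw; have [] := (pa _ _ Dpy Dpw).2 fyw.
by apply/(G1E Dpw); rewrite wE.
Qed.

Let rG1 : regular_subtree G1.
Proof.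
have [p12 p21 pa pl] := isoF.
have [fF1 [o Fo] cF1 _] := rF1; have [fG2 _ _ dG2] := rG2.
split.
- apply: (@sub_finite_set _ _ (F1 `|` psi @` G2)).
    move=> x [Fx|[Dx Gx]]; [by left|right; exists (phi x) => //].
    exact: (p12 _ Dx).2.
  by rewrite finite_setU; split=> //; exact: finite_image.
- by exists o; exact: FG1.
- have toF x : G1 x -> walk_in (@adj q T) G1 x o.
    case=> [Fx|[Dx Gx]]; first exact: walk_sub FG1 (cF1 _ _ Fx Fo).
    have [z Fz] := G1walk (p12 _ Dx).1 Gx; rewrite (p12 _ Dx).2 => xz.
    exact: walk_trans xz (walk_sub FG1 (cF1 _ _ Fz Fo)).
  move=> x y Gx Gy; apply: walk_trans (toF _ Gx) _.
  exact: walk_sym (toF _ Gy).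
- move=> x Gx; have [ix|Dx] := pselect (internal F1 x).
    by right; apply: internal_sub ix.
  have /dG2[lx|ix] : G2 (phi x) by apply/G1E.
    by left; exact: G1leaf.
  by right; apply/G1internal.
Qed.

Lemma expand_iso :
  exists G, [/\ regular_subtree G, F1 `<=` G & iso_pair G G2 phi psi].
Proof.
have [p12 p21 pa pl] := isoF.
have DG1 x : forest_vertex G1 x -> forest_vertex F1 x.
  exact: forest_vertex_sub.
have DG2 x : forest_vertex G2 x -> forest_vertex F2 x.
  exact: forest_vertex_sub.
have D12 x : forest_vertex G1 x -> forest_vertex G2 (phi x).
  by move=> Gx /G1internal-/(_ (DG1 _ Gx)).
exists G1; split=> //; split.
- by move=> x Gx; split; [exact: D12|exact: (p12 _ (DG1 _ Gx)).2].
- move=> y Gy; have [Dy yE] := p21 _ (DG2 _ Gy); split=> //.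
  by move=> /(G1internal Dy); rewrite yE.
- move=> x y Gx Gy; have Dx := DG1 _ Gx; have Dy := DG1 _ Gy.
  split=> fxy.
    have [_ _ _ nG] := fxy.
    have [_ _ xy _] := (pa _ _ Dx Dy).1 (forest_adj_sub FG1 fxy).
    by split; [exact: D12|exact: D12|by []|move=> [/(G1E Dx) ? /(G1E Dy) ?]; apply: nG].
  have [_ _ _ nG] := fxy.
  have [_ _ xy _] := (pa _ _ Dx Dy).2 (forest_adj_sub FG2 fxy).
  by split=> //; move=> [/(G1E Dx) ? /(G1E Dy) ?]; apply: nG.
- move=> x Gx; have Dx := DG1 _ Gx; split=> [lx|]; last exact: G1leaf.
  by apply: forest_leaf => //; [exact: D12|apply/G1E => //; case: lx].
Qed.

End Expand.

End SubtreeTheory.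

Section NeretinGroup.
Variables (q : nat) (T : regular_tree q).
Implicit Types (F : set T) (f g : boundary T -> boundary T).

Let rayP (r : ray T) : is_ray (val r).
Proof. by have := valP r; rewrite inE. Qed.

Lemma end_in_forest F (e : boundary T) : finite_set F ->
  exists2 r : ray T,
    forall n, forest_adj F (val r n) (val r n.+1) & e = end_of r.
Proof.
move=> fF; set s := repr e; have [sinj sadj] := rayP s.
have [n nF] : exists n, forall k, ~ F (val s (n + k)).
  move/finite_seqP: fF => [l ->]; elim: l => [|x l [n IH]].
    by exists 0 => k /=; rewrite in_nil.
  have [[m sm]|nx] := pselect (exists m, val s m = x).
    exists (n + m.+1) => k /=; rewrite inE => /orP[/eqP xk|].
      have mk : m < n + m.+1 + k by rewrite -addnA ltn_addl// leq_addr.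
      by have := sinj _ _ (etrans xk (esym sm)) => mE; rewrite mE ltnn in mk.
    by rewrite -addnA; exact: IH.
  exists n => k /=; rewrite inE => /orP[/eqP xk|]; last exact: IH.
  by apply: nx; exists (n + k).
have rr : is_ray (fun k => val s (n + k)).
  split=> [i j /= ij|k]; last by rewrite addnS; exact: sadj.
  exact: addnI (sinj _ _ ij).
exists (SigSub (mem_set rr)) => [k|] /=.
  apply: forest_adjP; [exact: forest_notin (nF k)|by rewrite addnS; exact: sadj|].
  by case=> /nF.
by rewrite -[LHS]end_ofK; apply/end_ofP; exists n, 0 => k.
Qed.

Lemma ray_forest F1 F2 phi psi (r : ray T) : iso_pair F1 F2 phi psi ->
  (forall n, forest_adj F1 (val r n) (val r n.+1)) ->
  is_ray (phi \o val r) /\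
  forall n, forest_adj F2 (phi (val r n)) (phi (val r n.+1)).
Proof.
move=> [p12 _ pa _] rF; have [rinj radj] := rayP r.
have rD n : forest_vertex F1 (val r n) by have [] := rF n.
have pF n : forest_adj F2 (phi (val r n)) (phi (val r n.+1)) by apply/pa.
split=> //; split=> [i j /= ij|n]; last by have [] := pF n.
by apply: rinj; rewrite -(p12 _ (rD i)).2 ij (p12 _ (rD j)).2.
Qed.

Lemma sphero_id : spheromorphism (@id (boundary T)).
Proof.
have [o] := @vertex_inhabited q T.
exists (thicken [set o]), (thicken [set o]), id; split.
- exact: star_regular.
- exact: star_regular.
- by apply/forest_isoP; exists id; split.
- by move=> r _; exists r.
Qed.

Lemma sphero_comp f g :
  spheromorphism f -> spheromorphism g -> spheromorphism (f \o g).
Proof.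
move=> [F3 [F4 [phi2 [rF3 rF4 /forest_isoP[psi2 iso2] ind2]]]].
move=> [F1 [F2 [phi1 [rF1 rF2 /forest_isoP[psi1 iso1] ind1]]]].
have [G [rG FG2 FG3]] := common_regular rF2 rF3.
have [G1 [rG1 FG1 isoG1]] := expand_iso rF1 rF2 rG FG2 iso1.
have [G4 [rG4 FG4 isoG4]] := expand_iso rF4 rF3 rG FG3 (iso_pair_sym iso2).
exists G1, G4, (phi2 \o phi1); split=> //.
  apply/forest_isoP; exists (psi1 \o psi2).
  have [p12 p21 pa pl] := isoG1.
  have [q12 q21 qa ql] := iso_pair_sym isoG4.
  split.
  - move=> x /p12[Dx xE]; have [Dx' xE'] := q12 _ Dx.
    by split=> //=; rewrite xE'.
  - move=> x /q21[Dx xE]; have [Dx' xE'] := p21 _ Dx.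
    by split=> //=; rewrite xE'.
  - move=> x y Dx Dy; apply: iff_trans (pa _ _ Dx Dy) _.
    exact: qa (p12 _ Dx).1 (p12 _ Dy).1.
  - by move=> x Dx; apply: iff_trans (pl _ Dx) _; exact: ql (p12 _ Dx).1.
move=> r rG'.
have [s sE fs] := ind1 r (fun n => forest_adj_sub FG1 (rG' n)).
have [_ rG''] := ray_forest isoG1 rG'.
have [n|t tE ft] := ind2 s; first by rewrite sE; exact: forest_adj_sub (rG'' n).
by exists t; [rewrite tE sE|rewrite /= fs].
Qed.

Lemma sphero_inv f : spheromorphism f ->
  exists2 g, spheromorphism g & cancel f g /\ cancel g f.
Proof.
move=> [F1 [F2 [phi [rF1 rF2 /forest_isoP[psi iso]]]]] ind.
have [fF1 _ _ _] := rF1; have [fF2 _ _ _] := rF2.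
have iso' := iso_pair_sym iso.
have [p12 p21 _ _] := iso.
have finj : injective f.
  move=> e e'; have [r rF ->] := end_in_forest e fF1.
  have [r' rF' ->] := end_in_forest e' fF1.
  have [s sE ->] := ind _ rF; have [s' sE' ->] := ind _ rF'.
  move=> /end_ofP[m [n mn]]; apply/end_ofP; exists m, n => k.
  have := mn k; rewrite sE sE' /= => pE.
  have [Dr _ _ _] := rF (m + k); have [Dr' _ _ _] := rF' (n + k).
  by rewrite -(p12 _ Dr).2 pE (p12 _ Dr').2.
have psif (r : ray T) : (forall n, forest_adj F2 (val r n) (val r n.+1)) ->
    exists2 s : ray T, val s = psi \o val r & f (end_of s) = end_of r.
  move=> rF; have [rr rF'] := ray_forest iso' rF.
  exists (SigSub (mem_set rr)) => //.
  have [//|s sE ->] := ind (SigSub (mem_set rr)).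
  apply/end_ofP; exists 0, 0 => k; rewrite sE /=.
  by have [Dr _ _ _] := rF (0 + k); rewrite (p21 _ Dr).2.
have /choice[g gK] : forall e, exists e', f e' = e.
  move=> e; have [r rF ->] := end_in_forest e fF2.
  by have [s _ <-] := psif _ rF; exists (end_of s).
exists g; last by split=> // e; apply: finj; rewrite gK.
exists F2, F1, psi; split=> //; first by apply/forest_isoP; exists phi.
move=> r /psif[s sE fs]; exists s => //; apply: finj; by rewrite gK.
Qed.

Let neretinP (f : neretin T) : spheromorphism (val f).
Proof. by have := valP f; rewrite inE. Qed.

Definition neretin_one : neretin T := SigSub (mem_set sphero_id).

Definition neretin_mul (f g : neretin T) : neretin T :=
  SigSub (mem_set (sphero_comp (neretinP f) (neretinP g))).

Lemma neretin_inv_subproof (f : neretin T) :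
  exists g : neretin T, cancel (val f) (val g) /\ cancel (val g) (val f).
Proof.
have [g gs gK] := sphero_inv (neretinP f).
by exists (SigSub (mem_set gs)).
Qed.

Definition neretin_inv (f : neretin T) : neretin T :=
  sval (cid (neretin_inv_subproof f)).

Lemma neretin_mulA : associative neretin_mul.
Proof. by move=> f g h; apply: val_inj. Qed.

Lemma neretin_mul1 : left_id neretin_one neretin_mul.
Proof. by move=> f; apply: val_inj. Qed.

Lemma neretin_1mul : right_id neretin_one neretin_mul.
Proof. by move=> f; apply: val_inj. Qed.

Lemma neretin_mulV : left_inverse neretin_one neretin_inv neretin_mul.
Proof.
move=> f; apply: val_inj; apply/funext => e /=.
by rewrite /neretin_inv; case: cid => g /= [].
Qed.

Lemma neretin_Vmul : right_inverse neretin_one neretin_inv neretin_mul.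
Proof.
move=> f; apply: val_inj; apply/funext => e /=.
by rewrite /neretin_inv; case: cid => g /= [].
Qed.

HB.instance Definition _ := isGroup.Build (neretin T)
  neretin_mulA neretin_mul1 neretin_1mul neretin_mulV neretin_Vmul.

End NeretinGroup.

Section Automorphisms.
Variables (q : nat) (T : regular_tree q).

Definition is_automorphism (g : T -> T) :=
  bijective g /\ forall x y, adj (g x) (g y) = adj x y.

Definition Aut :=
  set_type [set g : {ptws T -> discrete_topology T} | is_automorphism g].

HB.instance Definition _ := Topological.on Aut.

Definition aut_fun (g : Aut) : T -> T := val g.

Lemma aut_funP (g : Aut) : is_automorphism (aut_fun g).
Proof. by have := valP g; rewrite inE. Qed.

Lemma aut_ray_subproof (g : Aut) (r : ray T) : is_ray (aut_fun g \o val r).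
Proof.
have : is_ray (val r) by have := valP r; rewrite inE.
have [/bij_inj ginj ga] := aut_funP g.
move=> [rinj ra]; split=> [|n]; first exact: inj_comp.
exact: etrans (ga _ _) (ra n).
Qed.

Definition aut_ray (g : Aut) (r : ray T) : ray T :=
  SigSub (mem_set (aut_ray_subproof g r)).

Definition aut_boundary (g : Aut) (e : boundary T) : boundary T :=
  end_of (aut_ray g (repr e)).

Lemma aut_boundaryE g r : aut_boundary g (end_of r) = end_of (aut_ray g r).
Proof.
apply/end_ofP; have /end_ofP[m [n mn]] := end_ofK (end_of r).
by exists m, n => k /=; rewrite mn.
Qed.

Lemma aut_spheromorphism g : spheromorphism (aut_boundary g).
Proof.
have [[h gK hK] ga] := aut_funP g.
have ginj := can_inj gK.
have [o] := @vertex_inhabited q T.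
set F : set T := thicken [set o].
have rF : regular_subtree F by exact: star_regular.
have ha x y : adj (h x) (h y) = adj x y by rewrite -ga !hK.
pose F' : set T := thicken [set aut_fun g o].
have rF' : regular_subtree F' by exact: star_regular.
have FE x : F x <-> F' (aut_fun g x).
  split; first by case=> [->|[_ -> ox]]; [left|right; exists (aut_fun g o); rewrite ?ga].
  by case=> [/ginj ->|[_ -> ox]]; [left|right; exists o => //; rewrite -ga].
have F'E x : F' x <-> F (h x) by rewrite -{1}(hK x); exact: iff_sym (FE _).
have iE x : internal F x <-> internal F' (aut_fun g x).
  split=> /internal_full[Fx xF]; apply/internal_full; split; try exact/FE.
    by move=> y; rewrite -(hK y) ga => /xF; apply: (FE _).1.
  by move=> y; rewrite -ga => /xF /FE.
have lE x : leaf F x <-> leaf F' (aut_fun g x).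
  split=> -[Fx /degree_one[u [Fu xu uu]]].
    split; first exact/FE.
    apply/degree_one; exists (aut_fun g u); rewrite ga; split=> //; first exact/FE.
    move=> y; rewrite -(hK y) ga => /FE Fy xy; congr (aut_fun g _); exact: uu.
  split; first exact/FE.
  apply/degree_one; exists (h u); split; [exact/F'E|by rewrite -ga hK|].
  by move=> y Fy xy; rewrite -(gK y); congr h; apply: uu; [exact/FE|rewrite ga].
exists F, F', (aut_fun g); split=> //.
  apply/forest_isoP; exists h; split.
  - by move=> x Dx; split=> // /iE.
  - by move=> x Dx; split=> //; rewrite /forest_vertex iE hK.
  - move=> x y _ _; rewrite /forest_adj /forest_vertex ga.
    by rewrite (propext (iE x)) (propext (iE y)) (propext (FE x)) (propext (FE y)).
  - by move=> x _; exact: lE.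
by move=> r _; exists (aut_ray g r); rewrite ?aut_boundaryE.
Qed.

Definition aut_embedding (g : Aut) : neretin T :=
  SigSub (mem_set (aut_spheromorphism g)).

End Automorphisms.

Section GroupTopologies.

Record topology_on (X : choiceType) := TopologyOn {
  opens : set_system X;
  opensT : opens [set: X];
  opensI : setI_closed opens;
  opens_bigcup : forall (I : Type) (f : I -> set X),
    (forall i, opens (f i)) -> opens (\bigcup_i f i)
}.

Definition with_topology (X : choiceType) (tau : topology_on X) : Type := X.

HB.instance Definition _ (X : choiceType) (tau : topology_on X) :=
  Choice.copy (with_topology tau) X.
HB.instance Definition _ (X : choiceType) (tau : topology_on X) :=
  isOpenTopological.Build (with_topology tau)
    (@opensT X tau) (@opensI X tau) (@opens_bigcup X tau).

Lemma open_with_topology (X : choiceType) (tau : topology_on X)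
  (A : set (with_topology tau)) : open A = opens tau A.
Proof. by []. Qed.

Definition group_topology (G : groupType) (tau : topology_on G) :=
  continuous (fun p : with_topology tau * with_topology tau =>
    (p.1 * p.2 : G)%g : with_topology tau) /\
  continuous (fun x : with_topology tau => (x : G)^-1%g : with_topology tau).

Definition open_map (X Y : topologicalType) (f : X -> Y) :=
  forall A : set X, open A -> open (f @` A).

End GroupTopologies.

Definition neretin_topology (q : nat) (T : regular_tree q)
    (tau : topology_on (neretin T)) :=
  [/\ group_topology tau,
      continuous (aut_embedding (T := T) : Aut T -> with_topology tau)
    & open_map (aut_embedding (T := T) : Aut T -> with_topology tau)].

(* Main.v *)
Require Import Defs.
From HB Require Import structures.
From mathcomp Require Import all_boot finmap.
From mathcomp Require Import all_classical topology function_spaces.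
From mathcomp Require Import separation_axioms.

(** The stabilizers [fixator s] of finite sequences [s] of vertices are a base
    of neighbourhoods of the identity in [Aut T].  Their images in the Neretin
    group are subgroups, any two of them contain a third, and the whole point
    is that conjugation by a spheromorphism [g] is compatible with them
    ([conj_fixator]): the image of every stabilizer contains a [g]-conjugate of
    the image of another one.  Indeed, represent [g] by an isomorphism [phi]
    from [T \ G1] to [T \ G2], with [G2] so large that it contains [s].  An
    automorphism [a] which fixes [G1] pointwise permutes the vertices of
    [T \ G1], and [phi a phi^-1], extended by the identity on [G2], is an
    automorphism ([transport]) which induces [g a g^-1] on the boundary and
    fixes [s].

    A family of subgroups with these properties is a base of neighbourhoods of
    the identity for a group topology, in which the sets that contain a coset
    of a member of the family around each of their points are open
    ([subgroup_base_topology]).  For this topology the embedding of [Aut T] is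
    continuous and open.

    Uniqueness: in any topology for which the embedding is continuous and open,
    the neighbourhoods of 1 are the sets whose preimage is a neighbourhood of 1
    in [Aut T] ([neretin_topology_nbhs1]), and the neighbourhoods of 1
    determine a group topology ([group_topology_eq]).

    Cosets of the base subgroups are clopen, so the group is Hausdorff and
    totally disconnected as soon as these subgroups intersect trivially.  This
    holds because two rays with the same origin and the same end are equal
    ([ray_unique]), so that an automorphism fixing the origin of a ray and the
    end of the ray fixes the whole ray.  Finally, the stabilizer of a vertex is
    compact ([fixator_vertex_compact]), because it moves every other vertex
    inside a finite ball; its image is then a compact neighbourhood of 1. *)

Set Implicit Arguments.
Unset Strict Implicit.
Unset Printing Implicit Defensive.

Local Open Scope classical_set_scope.
Local Open Scope group_scope.

(** * Group topologies with a base of open subgroups *)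

(** The properties which make a family of subgroups the base of neighbourhoods
    of the identity for a group topology. *)
Record subgroup_base (G : groupType) (I : Type) (U : I -> set G) : Prop :=
  SubgroupBase {
    sub_inhabited : inhabited I;
    sub1 : forall i, U i 1;
    subM : forall i x y, U i x -> U i y -> U i (x * y);
    subV : forall i x, U i x -> U i x^-1;
    sub_directed : forall i j, exists k, U k `<=` U i `&` U j;
    sub_conj : forall g i, exists j, forall x, U j x -> U i (g * x * g^-1)
  }.

Section SubgroupBase.
Variables (G : groupType) (I : Type) (U : I -> set G).
Hypothesis baseU : subgroup_base U.

Definition subgroup_base_opens : set_system G :=
  [set A | forall x, A x -> exists i, forall u, U i u -> A (x * u)].

Lemma subgroup_base_opensT : subgroup_base_opens [set: G].
Proof. by move=> x _; have [i] := sub_inhabited baseU; exists i. Qed.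

Lemma subgroup_base_opensI : setI_closed subgroup_base_opens.
Proof.
move=> A B oA oB x [/oA[i iA] /oB[j jB]].
have [k ijk] := sub_directed baseU i j; exists k => u /ijk[/iA ? /jB ?].
by split.
Qed.

Lemma subgroup_base_opens_bigcup (J : Type) (f : J -> set G) :
  (forall j, subgroup_base_opens (f j)) ->
  subgroup_base_opens (\bigcup_j f j).
Proof.
move=> of_ x [j _ /of_[i iF]]; exists i => u /iF fj.
by exists j.
Qed.

Definition subgroup_base_topology : topology_on G :=
  TopologyOn subgroup_base_opensT subgroup_base_opensI
    subgroup_base_opens_bigcup.

Local Notation Gt := (with_topology subgroup_base_topology).

Lemma subgroup_base_coset_open i (x : G) :
  open ([set y | U i (x^-1 * y)] : set Gt).
Proof.
move=> y iy; exists i => u iu.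
by rewrite /= mulgA; apply: (subM baseU).
Qed.

(** The complement of a coset is a union of cosets of the same subgroup. *)
Lemma subgroup_base_coset_clopen i (x : G) :
  clopen ([set y | U i (x^-1 * y)] : set Gt).
Proof.
split; first exact: subgroup_base_coset_open.
rewrite -openC open_with_topology => y niy; exists i => u iu /= ixyu.
apply: niy => /=.
rewrite -(mulgK u (x^-1 * y)) -(mulgA x^-1); apply: (subM baseU) => //.
exact: (subV baseU).
Qed.

Lemma subgroup_base_nbhsP (x : G) (A : set G) :
  nbhs (x : Gt) A <-> exists i, forall u, U i u -> A (x * u).
Proof.
split=> [|[i iA]].
  rewrite nbhsE => -[B [oB Bx] BA]; have [i iB] := oB _ Bx.
  by exists i => u /iB/BA.
rewrite nbhsE; exists [set y | U i (x^-1 * y)].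
  split; first exact: subgroup_base_coset_open.
  by rewrite /= mulVg; exact: sub1 baseU i.
by move=> y /iA; rewrite mulgA mulgV mul1g.
Qed.

(** Conjugation-invariance of the base is what makes multiplication and
    inversion continuous away from the identity, since
    [(x u) (y v) = x y (y^-1 u y) v] and [(x u)^-1 = x^-1 (x u^-1 x^-1)]. *)
Lemma subgroup_base_group_topology : group_topology subgroup_base_topology.
Proof.
split=> [[x y] A /subgroup_base_nbhsP[i iA]|x A /subgroup_base_nbhsP[i iA]].
  have [j ji] := sub_conj baseU y^-1 i.
  exists ([set x' | U j (x^-1 * x')], [set y' | U i (y^-1 * y')]) => /=.
    split; apply/subgroup_base_nbhsP; [exists j|exists i];
      by move=> u ?; rewrite /= mulKg.
  move=> [x' y'] /= [/ji + iy]; rewrite invgK => jx.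
  have := iA _ (subM baseU jx iy); congr A.
  by rewrite -!mulgA !mulVKg.
apply/subgroup_base_nbhsP; have [j ji] := sub_conj baseU x i.
exists j => u /(subV baseU)/ji/iA /=.
by rewrite !mulgA mulVg mul1g invgM.
Qed.

Lemma subgroup_base_zero_dimensional :
  (forall x, (forall i, U i x) -> x = 1) -> zero_dimensional Gt.
Proof.
move=> U1 x y xy.
have [i niy] : exists i, ~ U i ((x : G)^-1 * y).
  apply: contrapT => /forallNP Uxy.
  have /U1 xy1 : forall i, U i ((x : G)^-1 * y).
    by move=> i; have := Uxy i; apply: contrapT.
  by case/eqP: xy; rewrite -(mulVKg (x : G) y) xy1 mulg1.
exists [set z | U i ((x : G)^-1 * z)]; split=> //.
  exact: subgroup_base_coset_clopen.
by rewrite /= mulVg; exact: sub1 baseU i.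
Qed.

End SubgroupBase.

Lemma zero_dimensional_hausdorff (X : topologicalType) :
  zero_dimensional X -> hausdorff_space X.
Proof.
move=> zX x y clxy; apply: contrapT => /eqP xy.
have [A [[oA cA] Ax nAy]] := zX _ _ xy.
have [z [Az]] := clxy A (~` A) (open_nbhs_nbhs (conj oA Ax))
  (open_nbhs_nbhs (conj (closed_openC cA) nAy)).
exact.
Qed.

Lemma group_topology_translate (G : groupType) (tau : topology_on G) (g : G) :
  group_topology tau ->
  continuous (fun x : with_topology tau => (g * x : G) : with_topology tau).
Proof.
move=> [mulC _] x A nA; have [[P Q] [/= nP nQ] PQA] := mulC (g, x) A nA.
apply: filterS nQ => y Qy; apply: (PQA (g, y)); split=> //=.
exact: (@nbhs_singleton (with_topology tau)) nP.
Qed.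

(** Since translations are homeomorphisms, the open sets of a group topology
    can be read off from the neighbourhoods of the identity. *)
Lemma group_topology_nbhs1 (G : groupType) (tau : topology_on G) (A : set G) :
  group_topology tau ->
  (opens tau A <-> forall g, A g ->
     nbhs (1 : with_topology tau) [set x | A (g * x)]).
Proof.
move=> gtau; split=> [oA g Ag|nA].
  apply: group_topology_translate => //.
  by apply: open_nbhs_nbhs; split=> //; rewrite mulg1.
rewrite -open_with_topology openE => g Ag.
have := @group_topology_translate _ _ g^-1 gtau g [set x | A (g * x)].
rewrite mulVg => /(_ (nA _ Ag)).
apply: (@filterS _ (nbhs (g : with_topology tau))) => x /=.
by rewrite mulVKg.
Qed.

Lemma group_topology_eq (G : groupType) (tau tau' : topology_on G) :
  group_topology tau -> group_topology tau' ->
  (forall A : set G, nbhs (1 : with_topology tau) A <->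
                     nbhs (1 : with_topology tau') A) ->
  tau = tau'.
Proof.
move=> gtau gtau' nn; have : opens tau = opens tau'.
  apply/seteqP; split=> A /group_topology_nbhs1-/(_ _)/= oA.
    by apply/group_topology_nbhs1 => // g /oA-/(_ gtau)/nn.
  by apply/group_topology_nbhs1 => // g /oA-/(_ gtau')/nn.
case: tau tau' {gtau gtau' nn} => [o oT oI oU] [o' oT' oI' oU'] /= oo'.
by subst o'; congr TopologyOn; exact: Prop_irrelevance.
Qed.

(** The compact neighbourhood of [x] is the coset [x (U i)]; it is also closed,
    as a coset of an open subgroup. *)
Lemma subgroup_base_locally_compact (G : groupType) (I : Type)
    (U : I -> set G) (baseU : subgroup_base U) (i : I) :
  compact (U i : set (with_topology (subgroup_base_topology baseU))) ->
  locally_compact [set: with_topology (subgroup_base_topology baseU)].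
Proof.
set Gt := with_topology _ => cU x _.
exists ([set y | U i ((x : G)^-1 * y)] : set Gt).
  apply/subgroup_base_nbhsP; exists i => u iu _.
  by rewrite /= mulKg.
have [_ cV] := subgroup_base_coset_clopen baseU i x; split=> //.
rewrite (_ : mkset _ = (fun y : Gt => ((x : G) * y : Gt)) @` U i).
  apply: (@continuous_compact Gt Gt) => //; apply: continuous_subspaceT.
  exact/group_topology_translate/subgroup_base_group_topology.
apply/seteqP; split=> [y ixy|_ [u iu <-]]; last by rewrite /= mulKg.
by exists ((x : G)^-1 * y) => //; rewrite mulVKg.
Qed.

(** * The automorphism group of a locally finite tree *)

Section AutomorphismGroup.
Variables (q : nat) (T : regular_tree q).

Lemma aut_eq (a b : Aut T) : aut_fun a =1 aut_fun b -> a = b.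
Proof. by move=> ab; apply/val_inj/funext. Qed.

Definition mk_aut (g : T -> T) (gP : is_automorphism g) : Aut T :=
  SigSub (mem_set gP).

Lemma is_automorphism_id : is_automorphism (id : T -> T).
Proof. by split=> //; exists id. Qed.

Lemma is_automorphism_comp (g h : T -> T) :
  is_automorphism g -> is_automorphism h -> is_automorphism (g \o h).
Proof.
move=> [bg ag] [bh ah]; split; first exact: bij_comp.
by move=> x y /=; rewrite ag.
Qed.

Lemma is_automorphism_inv (g h : T -> T) :
  is_automorphism g -> cancel g h -> cancel h g -> is_automorphism h.
Proof.
by move=> [_ ag] gK hK; split=> [|x y]; [exists g|rewrite -ag !hK].
Qed.

Definition aut_one : Aut T := mk_aut is_automorphism_id.

Definition aut_mul (a b : Aut T) : Aut T :=
  mk_aut (is_automorphism_comp (aut_funP a) (aut_funP b)).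

Lemma aut_inv_subproof (a : Aut T) : exists b : Aut T,
  cancel (aut_fun a) (aut_fun b) /\ cancel (aut_fun b) (aut_fun a).
Proof.
have [[h aK hK] _] := aut_funP a.
by exists (mk_aut (is_automorphism_inv (aut_funP a) aK hK)).
Qed.

Definition aut_inv (a : Aut T) : Aut T := sval (cid (aut_inv_subproof a)).

Lemma aut_invK (a : Aut T) : cancel (aut_fun a) (aut_fun (aut_inv a)).
Proof. by rewrite /aut_inv; case: cid => b []. Qed.

Lemma aut_Kinv (a : Aut T) : cancel (aut_fun (aut_inv a)) (aut_fun a).
Proof. by rewrite /aut_inv; case: cid => b []. Qed.

Lemma aut_mulA : associative aut_mul.
Proof. by move=> a b c; apply: aut_eq. Qed.

Lemma aut_mul1 : left_id aut_one aut_mul.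
Proof. by move=> a; apply: aut_eq. Qed.

Lemma aut_1mul : right_id aut_one aut_mul.
Proof. by move=> a; apply: aut_eq. Qed.

Lemma aut_mulV : left_inverse aut_one aut_inv aut_mul.
Proof. by move=> a; apply: aut_eq => x; exact: aut_invK. Qed.

Lemma aut_Vmul : right_inverse aut_one aut_inv aut_mul.
Proof. by move=> a; apply: aut_eq => x; exact: aut_Kinv. Qed.

HB.instance Definition _ := isGroup.Build (Aut T)
  aut_mulA aut_mul1 aut_1mul aut_mulV aut_Vmul.

Lemma aut_funM (a b : Aut T) : aut_fun (a * b) = aut_fun a \o aut_fun b.
Proof. by []. Qed.

Lemma aut_embeddingM (a b : Aut T) :
  aut_embedding (a * b) = aut_embedding a * aut_embedding b.
Proof.
apply/val_inj/funext => e /=; rewrite -(end_ofK e) !aut_boundaryE.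
by apply/end_ofP; exists 0%N, 0%N.
Qed.

Lemma aut_embedding1 : aut_embedding (1 : Aut T) = 1.
Proof.
by apply: (mulgI (aut_embedding 1)); rewrite -aut_embeddingM !mulg1.
Qed.

Lemma aut_embeddingV (a : Aut T) : aut_embedding a^-1 = (aut_embedding a)^-1.
Proof.
apply: (mulgI (aut_embedding a)).
by rewrite -aut_embeddingM !mulgV aut_embedding1.
Qed.

Definition fixator (s : seq T) : set (Aut T) :=
  [set a | {in s, aut_fun a =1 id}].

Lemma fixator_cat s t : fixator (s ++ t) = fixator s `&` fixator t.
Proof.
apply/seteqP; split=> [a st|a [sa ta] v].
  by split=> v vs; apply: st; rewrite mem_cat vs ?orbT.
by rewrite mem_cat => /orP[/sa|/ta].
Qed.

Lemma fixator1 s : fixator s 1.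
Proof. by []. Qed.

Lemma fixatorM s a b : fixator s a -> fixator s b -> fixator s (a * b).
Proof. by move=> sa sb v vs; rewrite aut_funM /= sb// sa. Qed.

Lemma fixatorV s a : fixator s a -> fixator s a^-1.
Proof. by move=> sa v vs; rewrite -[in LHS](sa v vs); exact: aut_invK. Qed.

(** The cylinders on the right-hand side form a filter, which converges to [a]
    because it does so at each vertex; hence it contains the neighbourhoods of
    [a] for the product topology. *)
Lemma aut_nbhsP (a : Aut T) (A : set (Aut T)) : nbhs a A <->
  exists s : seq T, forall b, {in s, aut_fun b =1 aut_fun a} -> A b.
Proof.
split=> [[_ [[C oC <-] Ca CA]]|[s sA]].
  pose F : set_system {ptws T -> discrete_topology T} :=
    filter_from [set: seq T] (fun s => [set f : T -> T | {in s, f =1 val a}]).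
  have FF : Filter F.
    apply: filter_from_filter; first by exists [::].
    move=> s t _ _; exists (s ++ t) => // f st.
    by split=> v vs; apply: st; rewrite mem_cat vs ?orbT.
  have : F --> (val a : {ptws T -> discrete_topology T}).
    apply/cvg_sup => v B [_ [[D oD <-] Dv DB]].
    exists [:: v] => // f /= fv; apply: DB; rewrite /= fv ?mem_seq1//.
  move=> /(_ C (open_nbhs_nbhs (conj oC Ca)))[s _ sC].
  by exists s => b bs; apply: CA; apply: sC.
apply: (filterS sA); elim: s {sA} => [|v s IH].
  by apply: filterS filterT => b _.
have nv : nbhs a [set b | aut_fun b v = aut_fun a v].
  apply: (@initial_continuous (Aut T) {ptws T -> discrete_topology T} val
    a [set f | f v = val a v]).
  apply: (@proj_continuous T (fun=> discrete_topology T) v (val a)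
    [set aut_fun a v]).
  by rewrite nbhs_principalE.
apply: filterS (filterI nv IH) => b [bv bs] w.
by rewrite inE => /orP[/eqP->|/bs].
Qed.

End AutomorphismGroup.

Section StabilizerCompact.
Variables (q : nat) (T : regular_tree q).

(** An ultrafilter picks one set in any finite partition. *)
Lemma ultra_finite_preimage (X : Type) (Y : eqType) (f : X -> Y) (s : seq Y)
    (F : set_system X) : UltraFilter F ->
  F (f @^-1` [set` s]) -> exists2 y, y \in s & F (f @^-1` [set y]).
Proof.
move=> UF; have PF := @ultra_proper _ _ UF.
elim: s => [|y s IH] Fs.
  by have [x] := filter_ex Fs; rewrite /= in_nil.
have [Fy|Fny] := in_ultra_setVsetC (f @^-1` [set y]) UF.
  by exists y => //; exact: mem_head.
have [|w ws Fw] := IH; last by exists w => //; rewrite inE ws orbT.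
apply: filterS (filterI Fs Fny) => x [/=].
by rewrite inE => /orP[/eqP|].
Qed.

(** The neighbours of [x] are sent injectively to those of [f x], which are in
    the same finite number, so every neighbour of [f x] is reached; the tree
    being connected, this propagates from one vertex to all of them. *)
Lemma injective_adj_surjective (f : T -> T) :
  injective f -> (forall x y, adj (f x) (f y) = adj x y) ->
  forall y, exists x, f x = y.
Proof.
move=> finj fa y; have [o] := @vertex_inhabited q T.
have [p [+ <- _]] := @tree_connected q T (f o) y I I.
elim: p o => [|z p IH] o /=; first by exists o.
move=> /andP[oz zp].
have : (f @` [set x | adj o x]) z.
  apply: (card_full (B := [set z | adj (f o) z]) (n := q.+1)) => //.
  - by move=> _ [x ox <-]; rewrite /= fa.
  - exact: tree_degree.
  - apply: card_eq_trans (tree_degree o).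
    by apply: inj_card_eq => ? ? _ _ /finj.
by move=> [x _ xz]; move: zp; rewrite -xz; exact: IH.
Qed.

(** Along an ultrafilter on the stabilizer of [o], the image of each vertex [v]
    is eventually constant: this is so for [o], and if it is so for [x] with
    value [w] then the image of a neighbour of [x] is confined to the finitely
    many neighbours of [w].  The resulting limit map [f] inherits injectivity
    and adjacency from the automorphisms which agree with it at two vertices,
    and is then surjective by counting neighbours. *)
Lemma fixator_vertex_compact (o : T) : compact (fixator [:: o]).
Proof.
rewrite compact_ultra => F UF Fo; have PF := @ultra_proper _ _ UF.
have /choice[f fF] : forall v, exists w, F [set a | aut_fun a v = w].
  move=> v; have [p [+ <- _]] := @tree_connected q T o v I I.
  have : exists w, F [set a | aut_fun a o = w].
    by exists o; apply: filterS Fo => a; apply; exact: mem_head.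
  elim: p o {Fo} => [|y p IH] x //= [w Fw] /andP[xy yp].
  apply: IH yp; have /finite_seqP[s Ns] : finite_set [set z | adj w z].
    by apply/finite_setP; exists q.+1; exact: tree_degree.
  have [|z _ Fz] := @ultra_finite_preimage _ _ (fun a => aut_fun a y) s F UF.
    apply: filterS Fw => a aw; rewrite -Ns /= -aw.
    by have [_ ->] := aut_funP a.
  by exists z.
have finj : injective f.
  move=> x y fxy; have [a [ax ay]] := filter_ex (filterI (fF x) (fF y)).
  have [/bij_inj ainj _] := aut_funP a.
  by apply: ainj; rewrite ax ay.
have fa x y : adj (f x) (f y) = adj x y.
  have [a [<- <-]] := filter_ex (filterI (fF x) (fF y)).
  by have [_ ->] := aut_funP a.
have /choice[h fK] := injective_adj_surjective finj fa.
have fP : is_automorphism f.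
  by split=> //; exists h => // x; apply: finj; rewrite fK.
exists (mk_aut fP); split.
  move=> v; rewrite mem_seq1 => /eqP ->; change (f o = o).
  have [a [ao <-]] := filter_ex (filterI Fo (fF o)).
  by rewrite ao ?mem_head.
move=> A /aut_nbhsP[s sA]; apply: filterS sA _.
elim: s => [|v s IH]; first by apply: filterS filterT.
apply: filterS (filterI (fF v) IH) => a [av as_] w.
by rewrite inE => /orP[/eqP->|/as_].
Qed.

End StabilizerCompact.

(** * Ends of the tree and stabilizers *)

Section Ends.
Variables (q : nat) (T : regular_tree q).

Lemma ray_walk (r : nat -> T) (A : set T) i j :
  (forall k, adj (r k) (r k.+1)) -> (forall k, i <= k -> A (r k)) ->
  i <= j -> walk_in (@adj q T) A (r i) (r j).
Proof.
move=> ra rA /subnK <-; elim: (j - i)%N => [|k IH]; first exact: walk_refl.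
apply: walk_trans IH _; apply: walk_step (ra _) _ (walk_refl _ _).
by rewrite -addSn; apply: rA; rewrite leq_addl.
Qed.

(** Where two rays that meet again first part, both next vertices are
    neighbours of the parting point [val r i], in the connected set [F] of the
    later vertices of both rays; in a tree they must coincide. *)
Lemma ray_unique (r s : ray T) :
  val r 0 = val s 0 -> end_of r = end_of s -> r = s.
Proof.
have := valP r; rewrite inE => -[rinj ra].
have := valP s; rewrite inE => -[sinj sa].
move=> rs0 /end_ofP[m [n mn]]; apply/val_inj/funext; elim=> [//|i rsi].
pose F := [set x : T | exists2 j, i < j & x = val r j \/ x = val s j].
have Fr k : i < k -> F (val r k) by exists k => //; left.
have Fs k : i < k -> F (val s k) by exists k => //; right.
have walk_s j : i < j -> walk_in (@adj q T) F (val r i.+1) (val s j).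
  move=> ij; apply: walk_trans (ray_walk sa Fs ij).
  apply: (@walk_trans _ _ _ _ (val r (m + i.+1))).
    by apply: ray_walk => //; rewrite leq_addl.
  rewrite mn; apply: walk_sym; first exact: Fs.
  by apply: ray_walk => //; rewrite leq_addl.
have walkF x : F x -> walk_in (@adj q T) F (val r i.+1) x.
  by move=> [j ij [->|->]]; [exact: ray_walk|exact: walk_s].
apply: (@uniq_nbr _ _ F (val r i)).
- move=> x y Fx Fy; apply: walk_trans (walkF y Fy).
  by apply: walk_sym (walkF x Fx); exact: Fr.
- exact: Fr.
- exact: Fs.
- move=> [j ij [/rinj|]]; first by move=> ji; rewrite ji ltnn in ij.
  by rewrite rsi => /sinj ji; rewrite ji ltnn in ij.
- by rewrite adj_sym.
- by rewrite rsi adj_sym.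
Qed.

(** Let [z] be in all the images and [r] be a ray.  An automorphism [a] fixing
    the origin of [r] and inducing [z] may move [r]; but for each [n] there is
    another one, [b], which also fixes the vertex [val r n].  Both send [r] to
    a ray with the same origin and the same end, hence to the same ray, so that
    [a] fixes [val r n] too. *)
Lemma embedded_fixators_separate (z : neretin T) :
  (forall s, (@aut_embedding q T @` fixator s) z) -> z = 1.
Proof.
move=> zfix; apply/val_inj/funext => e /=; rewrite -(end_ofK e).
set r := repr e; have [a ar za] := zfix [:: val r 0].
suff ar_r : aut_ray a r = r by rewrite -za /= aut_boundaryE ar_r.
apply/val_inj/funext => n /=.
have [b br zb] := zfix [:: val r 0; val r n].
have ab : aut_ray a r = aut_ray b r.
  apply: ray_unique; first by rewrite /= ar ?br ?mem_head.
  by rewrite -!aut_boundaryE; have /= := congr1 val (etrans za (esym zb)) => ->.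
have /= := congr1 (fun r : ray T => val r n) ab => ->.
by apply: br; rewrite !inE eqxx orbT.
Qed.

Lemma regular_subtree_cover (s : seq T) :
  exists2 F : set T, regular_subtree F & [set` s] `<=` F.
Proof.
elim: s => [|x s [F rF sF]].
  by have [o] := @vertex_inhabited q T; exists (thicken [set o]) => //;
    exact: star_regular.
have [H [rH FH xH]] := common_regular rF (star_regular x).
exists H => // y /=; rewrite inE => /orP[/eqP->|/sF/FH//].
by apply: xH; left.
Qed.

End Ends.

(** * Conjugating stabilizers by spheromorphisms *)

Section Transport.
Variables (q : nat) (T : regular_tree q) (F1 F2 : set T) (phi psi : T -> T).
Hypothesis rF2 : regular_subtree F2.
Hypothesis isoF : iso_pair F1 F2 phi psi.

Lemma fixing_mem (a : T -> T) x : injective a ->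
  {in F1, a =1 id} -> F1 (a x) <-> F1 x.
Proof.
move=> ainj aF; split=> [Fax|Fx]; last by rewrite aF ?inE.
by rewrite -(ainj _ _ (aF _ (mem_set Fax))).
Qed.

Lemma fixing_forest_vertex (a : T -> T) x : injective a ->
  {in F1, a =1 id} -> forest_vertex F1 x -> forest_vertex F1 (a x).
Proof.
move=> ainj aF Dx iax; have [Fax _] := iax; apply: Dx.
by rewrite -(aF x) // inE; exact: (fixing_mem _ ainj aF).1.
Qed.

(** The automorphism [phi a phi^-1] of the forest [T \ F2], extended by the
    identity to the internal vertices of [F2].  It is meant for an [a] which
    fixes [F1] pointwise; then [phi a phi^-1] fixes the leaves of [F2], and the
    two parts fit together. *)
Definition transport (a : T -> T) (y : T) : T :=
  if `[< internal F2 y >] then y else phi (a (psi y)).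

Lemma transport_internal a y : internal F2 y -> transport a y = y.
Proof. by rewrite /transport => /asboolT ->. Qed.

Lemma transport_forest a y :
  forest_vertex F2 y -> transport a y = phi (a (psi y)).
Proof. by rewrite /transport => /asboolF ->. Qed.

Lemma transport_fix a y : {in F1, a =1 id} -> F2 y -> transport a y = y.
Proof.
have [p21 _ _ pl] := iso_pair_sym isoF.
move=> aF Fy; have [iy|Dy] := pselect (internal F2 y).
  exact: transport_internal.
rewrite transport_forest// aF; first exact: (p21 _ _).2.
by rewrite inE; have [] := (pl _ Dy).1 (forest_leaf rF2 Dy Fy).
Qed.

Variables (a b : T -> T).
Hypotheses (aK : cancel a b) (aF : {in F1, a =1 id}).

Lemma transportK : cancel (transport a) (transport b).
Proof.
have [p12 p21 _ _] := isoF.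
move=> y; have [iy|Dy] := pselect (internal F2 y).
  by rewrite !transport_internal.
have [Dpy py] := p21 _ Dy.
have [Dapy apy] := p12 _ (fixing_forest_vertex (can_inj aK) aF Dpy).
by rewrite transport_forest// transport_forest// apy aK.
Qed.

(** An edge of [T] is either inside [F2], where nothing moves, or an edge of
    the forest, where [phi], [a] and [psi] all preserve adjacency. *)
Lemma transport_adj x y : (forall x y, adj (a x) (a y) = adj x y) ->
  adj x y -> adj (transport a x) (transport a y).
Proof.
move=> aa xy; have [[Fx Fy]|nF] := pselect (F2 x /\ F2 y).
  by rewrite !transport_fix.
have [_ _ pa _] := isoF; have [_ _ qa _] := iso_pair_sym isoF.
have fxy : forest_adj F2 x y.
  have [Dx|/contrapT ix] := pselect (forest_vertex F2 x).
    exact: forest_adjP.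
  have Fy : F2 y by have /internal_full[_] := ix; apply.
  by case: nF; split=> //; case: ix.
have [Dx Dy _ _] := fxy.
have [Px Py pxy nFp] := (qa _ _ Dx Dy).1 fxy.
rewrite !transport_forest//.
have ainj := can_inj aK; have aD := fixing_forest_vertex ainj aF.
have [] // := (pa _ _ (aD _ Px) (aD _ Py)).1.
apply: forest_adjP (aD _ Px) _ _; first by rewrite aa.
by move=> [/(fixing_mem _ ainj aF) Fx /(fixing_mem _ ainj aF) Fy]; apply: nFp.
Qed.

End Transport.

Section ConjugateFixators.
Variables (q : nat) (T : regular_tree q).

Lemma transport_automorphism (F1 F2 : set T) (phi psi : T -> T) (a : Aut T) :
  regular_subtree F2 -> iso_pair F1 F2 phi psi ->
  {in F1, aut_fun a =1 id} ->
  is_automorphism (transport F2 phi psi (aut_fun a)).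
Proof.
move=> rF2 iso aF; set b := a^-1.
have bF : {in F1, aut_fun b =1 id}.
  by move=> x Fx; rewrite -[in LHS](aF x Fx); exact: aut_invK.
have aK : cancel (aut_fun a) (aut_fun b) by exact: aut_invK.
have bK : cancel (aut_fun b) (aut_fun a) by exact: aut_Kinv.
have [_ aa] := aut_funP a; have [_ ba] := aut_funP b.
have tK := transportK iso aK aF; have tK' := transportK iso bK bF.
split; first by exists (transport F2 phi psi (aut_fun b)).
move=> x y; apply/idP/idP; last first.
  by apply: (transport_adj rF2 iso aK aF aa).
by move=> /(transport_adj rF2 iso bK bF ba); rewrite !tK.
Qed.

(** It is enough to compare both sides on rays of the forest [T \ F1], where
    [f] is given by [phi]. *)
Lemma transport_conj (F1 F2 : set T) (phi psi : T -> T)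
    (f : boundary T -> boundary T) (a a' : Aut T) :
  regular_subtree F1 -> iso_pair F1 F2 phi psi -> induces F1 phi f ->
  {in F1, aut_fun a =1 id} ->
  aut_fun a' = transport F2 phi psi (aut_fun a) ->
  f \o aut_boundary a = aut_boundary a' \o f.
Proof.
move=> [fF1 _ _ _] iso ind aF a'E; apply/funext => e /=.
have [p12 _ _ _] := iso; have [/bij_inj ainj aa] := aut_funP a.
have [r rF ->] := end_in_forest e fF1.
have arF n : forest_adj F1 (val (aut_ray a r) n) (val (aut_ray a r) n.+1).
  have [D1 _ adj1 nF] := rF n.
  apply: forest_adjP; [exact: fixing_forest_vertex|by rewrite /= aa|].
  by move=> [/(fixing_mem _ ainj aF) ? /(fixing_mem _ ainj aF) ?]; apply: nF.
rewrite aut_boundaryE.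
have [s sE ->] := ind _ rF; have [t tE ->] := ind _ arF.
rewrite aut_boundaryE; apply/end_ofP; exists 0%N, 0%N => k.
rewrite tE /= sE a'E /=; have [Dr _ _ _] := rF (0 + k)%N.
by have [Dpr pr] := p12 _ Dr; rewrite transport_forest// pr.
Qed.

(** The subtree [F2] of [g] is first enlarged so as to contain [s], which
    enlarges [F1] accordingly to [G1]; [t] lists the vertices of [G1]. *)
Lemma conj_fixator (g : neretin T) (s : seq T) : exists t, forall x,
  (@aut_embedding q T @` fixator t) x ->
  (@aut_embedding q T @` fixator s) (g * x * g^-1).
Proof.
have : spheromorphism (val g) by have := valP g; rewrite inE.
move=> [F1 [F2 [phi [rF1 rF2 /forest_isoP[psi iso] ind]]]].
have [K rK sK] := regular_subtree_cover s.
have [G2 [rG2 FG2 KG2]] := common_regular rF2 rK.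
have [G1 [rG1 FG1 isoG]] := expand_iso rF1 rF2 rG2 FG2 iso.
have [/finite_seqP[t tE] _ _ _] := rG1.
exists t => _ [a at_ <-].
have aG1 : {in G1, aut_fun a =1 id} by move=> x; rewrite tE inE => /at_.
exists (mk_aut (transport_automorphism rG2 isoG aG1)).
  move=> v vs; apply: (transport_fix (F1 := G1)) => //.
  exact/KG2/sK.
apply: (mulIg g); rewrite mulgVK; apply/val_inj => /=.
apply/esym/(transport_conj rG1 isoG _ aG1) => // r rG.
by apply: ind => n; exact: forest_adj_sub (rG n).
Qed.

End ConjugateFixators.

(** * The topology of the Neretin group *)

Section NeretinTopology.
Variables (q : nat) (T : regular_tree q).

Lemma fixator_subgroup_base :
  subgroup_base (fun s : seq T => @aut_embedding q T @` fixator s).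
Proof.
split.
- exact: (inhabits [::]).
- by move=> s; exists 1; [exact: fixator1|exact: aut_embedding1].
- move=> s _ _ [a sa <-] [b sb <-]; exists (a * b); first exact: fixatorM.
  exact: aut_embeddingM.
- move=> s _ [a sa <-]; exists a^-1; first exact: fixatorV.
  exact: aut_embeddingV.
- move=> s t; exists (s ++ t) => _ [a + <-].
  by rewrite fixator_cat => -[sa ta]; split; exists a.
- exact: conj_fixator.
Qed.

Definition neretin_tau : topology_on (neretin T) :=
  subgroup_base_topology fixator_subgroup_base.

Lemma aut_embedding_continuous :
  continuous (@aut_embedding q T : Aut T -> with_topology neretin_tau).
Proof.
move=> a A /subgroup_base_nbhsP[s sA]; apply/aut_nbhsP; exists s => b ba.
rewrite /= -(mulVKg a b) aut_embeddingM; apply: sA; exists (a^-1 * b) => //.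
by move=> v vs; rewrite aut_funM /= ba//; exact: aut_invK.
Qed.

Lemma aut_embedding_open :
  open_map (@aut_embedding q T : Aut T -> with_topology neretin_tau).
Proof.
move=> A; rewrite openE => oA; rewrite open_with_topology => _ [a Aa <-].
have /aut_nbhsP[s sA] := oA _ Aa; exists s => _ [b sb <-].
exists (a * b); last exact: aut_embeddingM.
by apply: sA => v vs; rewrite aut_funM /= sb.
Qed.

Lemma neretin_topology_tau : neretin_topology neretin_tau.
Proof.
split; first exact: subgroup_base_group_topology.
- exact: aut_embedding_continuous.
- exact: aut_embedding_open.
Qed.

(** Continuity gives one implication and openness the other; the right-hand
    side does not depend on [tau]. *)
Lemma neretin_topology_nbhs1 (tau : topology_on (neretin T))
    (A : set (neretin T)) : neretin_topology tau ->
  nbhs (1 : with_topology tau) A <->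
  nbhs (1 : Aut T) (@aut_embedding q T @^-1` A).
Proof.
move=> [_ cE oE]; rewrite -aut_embedding1; split; first exact: cE.
rewrite nbhsE => -[B [oB B1] BA]; rewrite nbhsE.
exists (@aut_embedding q T @` B); last by move=> _ [a /BA ? <-].
by split; [exact: oE|exists 1].
Qed.

End NeretinTopology.

Theorem theorem4p4 (q : nat) (T : regular_tree q) :
  (2 <= q)%N ->
  exists tau : topology_on (neretin T),
    [/\ neretin_topology tau,
        (forall tau' : topology_on (neretin T),
           neretin_topology tau' -> tau' = tau),
        hausdorff_space (with_topology tau),
        locally_compact [set: with_topology tau]%classic
      & totally_disconnected [set: with_topology tau]%classic].
Proof.
move=> _; exists (neretin_tau T).
have zN : zero_dimensional (with_topology (neretin_tau T)).
  by apply: subgroup_base_zero_dimensional; exact: embedded_fixators_separate.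
split.
- exact: neretin_topology_tau.
- move=> tau ntau; have ntau' := neretin_topology_tau T.
  apply: group_topology_eq; [by case: ntau|by case: ntau'|move=> A].
  apply: iff_trans (neretin_topology_nbhs1 A ntau) _.
  exact: iff_sym (neretin_topology_nbhs1 A ntau').
- exact: zero_dimensional_hausdorff.
- have [o] := @vertex_inhabited q T.
  apply: (subgroup_base_locally_compact (i := [:: o])).
  apply: (@continuous_compact (Aut T) (with_topology (neretin_tau T))
    (@aut_embedding q T)); last exact: fixator_vertex_compact.
  exact/continuous_subspaceT/aut_embedding_continuous.
- exact: zero_dimension_totally_disconnected.
Qed.
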